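(* Let $n\ge 2$, let $F=F_n$ be the free group on generators $g_1,\dots,g_n$, let $F^{(1)}=[F,F]$ be its derived subgroup and $F^{(2)}=[F^{(1)},F^{(1)}]$. Let $K$ be an algebraically closed field of characteristic $0$. If $w\in F^{(1)}\setminus F^{(2)}$, then the word map $w:\mathrm{PSL}(2,K)^n\to \mathrm{PSL}(2,K)$ is surjective.
   Context: For a group $H$ and a reduced word $w=\prod_{i=1}^k g_{n_i}^{m_i}\in F_n$, the word map $w:H^n\to H$ is $(x_1,\dots,x_n)\mapsto \prod_{i=1}^k x_{n_i}^{m_i}$ (noncommutative product in the given order). *)

(* Defs.v *)
From HB Require Import structures.
From mathcomp Require Import all_boot all_order all_algebra.
Set Implicit Arguments. Unset Strict Implicit. Unset Printing Implicit Defensive.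
Import Order.TTheory GRing.Theory Num.Theory.

(* Free group F_n on generators g_0, ..., g_(n-1), as freely reduced words.
   A letter (i, false) stands for g_i, (i, true) for g_i^-1. *)
Definition letter (n : nat) := ('I_n * bool)%type.
Definition fword (n : nat) := seq (letter n).

Definition linv n (a : letter n) : letter n := (a.1, ~~ a.2).

Definition cons_red n (a : letter n) (w : fword n) : fword n :=
  if w is b :: w' then (if b == linv a then w' else a :: w) else [:: a].

Definition red n (w : fword n) : fword n := foldr (@cons_red n) [::] w.

Definition fmul n (u v : fword n) : fword n := red (u ++ v).
Definition finv n (u : fword n) : fword n := rev (map (@linv n) u).
Definition fcomm n (u v : fword n) : fword n :=
  fmul (fmul (finv u) (finv v)) (fmul u v).

Fixpoint reduced n (w : fword n) : bool :=
  match w with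
  | a :: ((b :: _) as w') => (b != linv a) && reduced w'
  | _ => true
  end.

Inductive derived n (S : fword n -> Prop) : fword n -> Prop :=
| der_one : derived S [::]
| der_comm u v : S u -> S v -> derived S (fcomm u v)
| der_mul u v : derived S u -> derived S v -> derived S (fmul u v)
| der_inv u : derived S u -> derived S (finv u).

Definition F1 n : fword n -> Prop := derived (fun _ => True).
Definition F2 n : fword n -> Prop := derived (@F1 n).

Definition word_map (K : fieldType) n (w : fword n) (x : 'I_n -> 'M[K]_2)
  : 'M[K]_2 :=
  (\prod_(a <- w) (if a.2 then (x a.1)^-1 else x a.1))%R.

Local Open Scope ring_scope.
Definition SL2 (K : fieldType) (A : 'M[K]_2) : Prop := \det A = 1.

(* Main.v *)
From Pilot Require Import Defs.
From HB Require Import structures.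
From mathcomp Require Import all_boot all_order all_algebra all_field.
From mathcomp Require Import zify ring.
From Stdlib Require Import Classical.
Import GRing.Theory.

(* mathcomp.fingraph also exports a constant named finv. *)
Import Pilot.Defs.

(* Two non-scalar 2x2 matrices with equal trace and determinant are conjugate, so
   it is enough to realise every trace, and one non-trivial unipotent element.

   Traces: attach distinct points of the projective line to the 2n letters and let
   a generator act as z on one of its points and as z^-1 on the other.  For a
   cyclically reduced word of length L > 0 the trace is a Laurent polynomial in z
   whose coefficients at z^L and z^-L are non-zero, hence it takes every value on
   non-zero z.

   Unipotents: on upper triangular matrices a word w in F^(1) is unipotent, and its
   off-diagonal entry records, for every edge of the Cayley graph of Z^n, the signed
   number of times that the path of w crosses it, each edge being weighted by a
   character of the diagonal torus.  If the entry vanishes identically, independence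
   of characters makes all these numbers zero.  Closing the edges along a section of
   F -> Z^n writes w as a product of elements of F^(1), one for each edge crossed; in
   F^(1)/F^(2) they cancel, so that w lies in F^(2). *)

Set Implicit Arguments.
Unset Strict Implicit.
Unset Printing Implicit Defensive.

(** * Free reduction of words *)

Section FreeReduction.

Variable n : nat.
Implicit Types (a b : letter n) (u v w : fword n).

Lemma linvK : involutive (@linv n).
Proof. by case=> i b; rewrite /linv /= negbK. Qed.

Lemma reducedE w : reduced w = sorted (fun a b => b != linv a) w.
Proof. by case: w => //= a w; elim: w a => //= b w IH a; rewrite IH. Qed.

Lemma red_id w : reduced w -> red w = w.
Proof.
elim: w => [|a [|b w] IH] // /andP[neq_ba red_w].
by rewrite -[LHS]/(cons_red a (red (b :: w))) IH //= (negbTE neq_ba).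
Qed.

Lemma reduced_cons_red a w : reduced w -> reduced (cons_red a w).
Proof.
case: w => [|b w] //= red_w; case: eqP => [_|/eqP neq_ba] /=.
  by case: w red_w => [|c w] //= /andP[].
by rewrite neq_ba.
Qed.

Lemma reduced_red w : reduced (red w).
Proof. by elim: w => //= a w; apply: reduced_cons_red. Qed.

Lemma red_red w : red (red w) = red w.
Proof. exact/red_id/reduced_red. Qed.

Lemma cons_redK a w : reduced w -> cons_red (linv a) (cons_red a w) = w.
Proof.
case: w => [|b w] /=; first by rewrite linvK eqxx.
case: eqP => [->|_] /=; last by rewrite linvK eqxx.
by case: w => [|c w] //= /andP[/negbTE->].
Qed.

Lemma red_cat u v : red (u ++ v) = foldr (@cons_red n) (red v) u.
Proof. exact: foldr_cat. Qed.

Lemma red_catr u v : red (u ++ red v) = red (u ++ v).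
Proof. by rewrite !red_cat red_red. Qed.

Lemma red_catl u v : red (red u ++ v) = red (u ++ v).
Proof.
elim: u => //= a u <-; case: (red u) => [|b u'] //=.
case: eqP => // ->.
by rewrite -{1}[a]linvK cons_redK // reduced_red.
Qed.

Lemma finvK : involutive (@finv n).
Proof. by move=> u; rewrite /finv map_rev revK mapK //; apply: linvK. Qed.

Lemma finv_cat u v : finv (u ++ v) = finv v ++ finv u.
Proof. by rewrite /finv map_cat rev_cat. Qed.

Lemma red_cancel u v w : red (u ++ v ++ finv v ++ w) = red (u ++ w).
Proof.
rewrite red_cat [RHS]red_cat; congr foldr.
elim/last_ind: v w => // v a IH w.
rewrite -cats1 finv_cat /= -catA /= -[RHS](IH w).
rewrite red_cat [RHS]red_cat; congr foldr => /=.
by rewrite -{1}[a]linvK cons_redK // reduced_red.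
Qed.

Lemma red_cancelV u v w : red (u ++ finv v ++ v ++ w) = red (u ++ w).
Proof. by rewrite -{2}[v]finvK red_cancel. Qed.

Lemma reduced_finv u : reduced u -> reduced (finv u).
Proof.
rewrite !reducedE /finv rev_sorted sorted_map; congr (is_true _).
apply: eq_sorted => a b /=; rewrite linvK.
by rewrite eq_sym.
Qed.

(** Under [red], either adjacent pair of [finv u ++ red u ++ finv (red u)] cancels. *)
Lemma red_finv u : red (finv u) = finv (red u).
Proof.
rewrite -[RHS]red_id; last exact/reduced_finv/reduced_red.
rewrite -[finv u]cats0 -(red_cancel _ (red u)) catA -red_catl red_catr red_catl.
by rewrite -catA (red_cancelV [::]) cats0.
Qed.

(** Allows a pair c, c^-1 to be deleted from a product at the cost of one commutator. *)
Lemma red_conj_mul (c p q : fword n) :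
  red (c ++ p ++ finv c ++ q) =
  fmul (fcomm (finv (red c)) (finv (red p))) (red (p ++ q)).
Proof.
rewrite /fcomm /fmul !finvK -!red_finv !(red_catl, red_catr) -!catA.
rewrite red_catl -(red_catr (c ++ p)) red_catl red_catr -!catA.
by rewrite [in RHS](catA c p) [in RHS](catA (c ++ p)) red_cancelV -!catA.
Qed.

End FreeReduction.

(** * Products whose factors cancel in the abelianization *)

Section BalancedProducts.

Variables (n : nat) (E : eqType) (C : E -> fword n).

Definition signed_word (t : E * bool) : fword n :=
  if t.2 then finv (C t.1) else C t.1.

Definition signed_prod (L : seq (E * bool)) : fword n :=
  flatten (map signed_word L).

(** Triviality of the signed product in the free abelian group on [E]. *)
Definition balanced (L : seq (E * bool)) :=
  forall e, count_mem (e, false) L = count_mem (e, true) L.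

Lemma signed_wordN e b : signed_word (e, ~~ b) = finv (signed_word (e, b)).
Proof. by case: b; rewrite /signed_word //= finvK. Qed.

Lemma signed_prod_cat L1 L2 :
  signed_prod (L1 ++ L2) = signed_prod L1 ++ signed_prod L2.
Proof. by rewrite /signed_prod map_cat flatten_cat. Qed.

Lemma balanced_remove e b L1 L2 :
  balanced ((e, b) :: L1 ++ (e, ~~ b) :: L2) -> balanced (L1 ++ L2).
Proof.
case: b => bal f; have := bal f; rewrite /= !count_cat /= !xpair_eqE;
  by case: (e == f) => /=; lia.
Qed.

Lemma balanced_opposite e b L :
  balanced ((e, b) :: L) -> (e, ~~ b) \in L.
Proof.
move=> /(_ e); rewrite -has_pred1 has_count /= !xpair_eqE eqxx /=.
by case: b => /=; lia.
Qed.

(* Delete an opposite pair from the list: c P c^-1 Q = [c^-1, P^-1] (P Q). *)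
Lemma derived_balanced (S : fword n -> Prop) (L : seq (E * bool)) :
    S [::] -> (forall u v, S u -> S v -> S (fmul u v)) ->
    (forall u, S u -> S (finv u)) ->
    (forall t, t \in L -> S (red (C t.1))) -> balanced L ->
  derived S (red (signed_prod L)).
Proof.
move=> S1 SM SV; have [m] := ubnP (size L).
elim: m L => // m IH [|[e b] L] szL SL bal; first exact: der_one.
have signedS t : t \in (e, b) :: L -> S (red (signed_word t)).
  by rewrite /signed_word => /SL; case: t.2 => // /SV; rewrite red_finv.
have prodS L' : {subset L' <= (e, b) :: L} -> S (red (signed_prod L')).
  elim: L' => // t L' IHL' sub.
  rewrite /signed_prod /= -red_catl -red_catr; apply: SM.
    by apply/signedS/sub/mem_head.
  by apply: IHL' => t' t'L; apply: sub; rewrite inE t'L orbT.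
have opp := balanced_opposite bal.
case/splitPr: L / opp szL SL bal signedS prodS => L1 L2 szL SL bal signedS prodS.
have -> : signed_prod ((e, b) :: L1 ++ (e, ~~ b) :: L2) =
    signed_word (e, b) ++ signed_prod L1 ++
    finv (signed_word (e, b)) ++ signed_prod L2.
  by rewrite -signed_wordN -cat1s !signed_prod_cat -[(e, ~~ b) :: L2]cat1s
    signed_prod_cat /signed_prod /= !cats0.
rewrite red_conj_mul -signed_prod_cat; apply: der_mul.
  apply: der_comm; apply: SV; first exact/signedS/mem_head.
  by apply: prodS => t tL1; rewrite inE mem_cat tL1 /= orbT.
apply: IH; last exact: balanced_remove bal.
  by move: szL; rewrite /= !size_cat /=; lia.
move=> t; rewrite mem_cat => tL; apply: SL.
by rewrite inE mem_cat inE; case/orP: tL => ->; rewrite !orbT.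
Qed.

Lemma sum_signs (R : pzRingType) e (L : seq (E * bool)) :
  (\sum_(t <- L | t.1 == e) (if t.2 then -1 else 1) =
   (count_mem (e, false) L)%:R - (count_mem (e, true) L)%:R :> R)%R.
Proof.
elim: L => [|[f b] L IH]; first by rewrite big_nil subr0.
rewrite big_cons /= IH !xpair_eqE; case: eqP => // _ /=.
case: b => /=; rewrite !natrD.
  by rewrite add0r opprD addrCA.
by rewrite add0r addrA.
Qed.

End BalancedProducts.

(** * The map F -> Z^n and paths in the Cayley graph of Z^n *)

Section Abelianization.

Local Open Scope ring_scope.

Variable n : nat.
Implicit Types (a : letter n) (u w : fword n) (v : {ffun 'I_n -> int}).

Definition unit_vec (i : 'I_n) : {ffun 'I_n -> int} := [ffun j => (j == i)%:R].

Definition ab_letter a := if a.2 then - unit_vec a.1 else unit_vec a.1.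

Definition ab w := \sum_(a <- w) ab_letter a.

Lemma ab_cat u w : ab (u ++ w) = ab u + ab w.
Proof. exact: big_cat. Qed.

Lemma ab_cons a w : ab (a :: w) = ab_letter a + ab w.
Proof. exact: big_cons. Qed.

Lemma ab_linv a : ab_letter (linv a) = - ab_letter a.
Proof. by case: a => i []; rewrite /ab_letter /= ?opprK. Qed.

Lemma ab_finv w : ab (finv w) = - ab w.
Proof.
rewrite /finv; elim: w => [|a w IH]; first by rewrite /ab !big_nil oppr0.
by rewrite /= rev_cons -cats1 ab_cat IH !ab_cons {2}/ab big_nil addr0 ab_linv
  opprD addrC.
Qed.

Lemma ab_red w : ab (red w) = ab w.
Proof.
elim: w => //= a w IH; rewrite ab_cons -IH.
case: (red w) => [|b w'] /=; first by rewrite ab_cons.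
case: eqP => [->|_]; last by rewrite ab_cons.
by rewrite ab_cons ab_linv addrA subrr add0r.
Qed.

Lemma ab_derived (S : fword n -> Prop) w : derived S w -> ab w = 0.
Proof.
elim=> [|u v _ _|u v _ IHu _ IHv|u _ IHu].
- exact: big_nil.
- rewrite /fcomm /fmul ab_red ab_cat !ab_red !ab_cat !ab_finv.
  by rewrite -opprD addNr.
- by rewrite /fmul ab_red ab_cat IHu IHv addr0.
- by rewrite ab_finv IHu oppr0.
Qed.

Lemma abE w i :
  ab w i = (count_mem (i, false) w)%:R - (count_mem (i, true) w)%:R.
Proof.
rewrite -sum_signs /ab sum_ffunE [RHS]big_mkcond /=; apply: eq_bigr => -[j b] _.
by rewrite /ab_letter /=; case: b; rewrite !ffunE eq_sym; case: eqP.
Qed.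

Lemma signed_prod_letters w : signed_prod (fun i => [:: (i, false)]) w = w.
Proof.
by elim: w => // -[i b] w IH; rewrite -cat1s signed_prod_cat IH; case: b.
Qed.

(** View [w] as a signed product of one-letter words; [ab w = 0] is exactly its balance. *)
Lemma F1_red w : ab w = 0 -> F1 (red w).
Proof.
move=> abw; rewrite -(signed_prod_letters w); apply: derived_balanced => // i.
have /ffunP/(_ i)/eqP := abw.
by rewrite abE ffunE subr_eq0 !natz eqz_nat => /eqP.
Qed.

(** The word g_0^(v 0) ... g_(n-1)^(v (n-1)), a section of [ab]. *)
Definition sec v : fword n :=
  flatten [seq nseq `|v i|%N (i, v i < 0) | i <- enum 'I_n].

Lemma sec0 : sec 0 = [::].
Proof.
by rewrite /sec; elim: (enum _) => //= i s ->; rewrite ffunE.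
Qed.

Lemma ab_sec v : ab (sec v) = v.
Proof.
apply/ffunP => j.
have -> : ab (sec v) j = \sum_(i <- enum 'I_n) if i == j then v i else 0.
  rewrite /sec; elim: (enum _) => [|i s IH] /=.
    by rewrite /ab !big_nil ffunE.
  rewrite ab_cat ffunE IH big_cons; congr (_ + _).
  rewrite abE !count_nseq /= !xpair_eqE; case: eqP => _ /=; last by lia.
  by case: (v i) => k /=; lia.
by rewrite big_enum -big_mkcond big_pred1_eq.
Qed.

(** The Schreier generator of the edge [e]: go from the origin to its initial vertex along [sec],
    cross it, and return along [sec]. *)
Definition edge_word (e : {ffun 'I_n -> int} * 'I_n) : fword n :=
  sec e.1 ++ [:: (e.2, false)] ++ finv (sec (e.1 + unit_vec e.2)).

(* The edge of the Cayley graph of Z^n crossed by the letter [a] at the vertex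
   [v]: edges are recorded by their initial vertex and direction, the sign [a.2]
   tells that the edge is crossed backwards. *)
Definition step v a : {ffun 'I_n -> int} * 'I_n * bool :=
  (if a.2 then v - unit_vec a.1 else v, a.1, a.2).

Fixpoint path_edges v w :=
  if w is a :: w' then step v a :: path_edges (v + ab_letter a) w' else [::].

Lemma signed_word_step v a :
  signed_word edge_word (step v a) =
  sec v ++ [:: a] ++ finv (sec (v + ab_letter a)).
Proof.
case: a => i []; rewrite /signed_word /step /edge_word /ab_letter //=.
by rewrite subrK finv_cat -cat1s finv_cat finvK /= -catA.
Qed.

(** Schreier rewriting: one edge word ends with the inverse of the section with which the next
    begins, so the product telescopes. *)
Lemma red_sec_cat v w :
  red (sec v ++ w) =
  red (signed_prod edge_word (path_edges v w) ++ sec (v + ab w)).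
Proof.
elim: w v => [|a w IH] v; first by rewrite /ab big_nil addr0 cats0.
rewrite /= -cat1s -[in RHS]cat1s signed_prod_cat ab_cons addrA.
rewrite {1}/signed_prod /= cats0 signed_word_step.
rewrite -[in RHS]catA -[in RHS]red_catr -IH red_catr -!catA.
by rewrite [in RHS]catA red_cancelV -catA.
Qed.

Lemma F1_edge_word e : F1 (red (edge_word e)).
Proof.
apply: F1_red; rewrite /edge_word !ab_cat ab_finv !ab_sec ab_cons.
by rewrite {1}/ab big_nil addr0 /ab_letter /= addrA subrr.
Qed.

(** The path of [w] is closed at 0, where the section is empty, so [w] is the product of its edge
    words; these lie in F^(1), and balance then puts the product in F^(2). *)
Lemma F2_balanced w :
  reduced w -> ab w = 0 -> balanced (path_edges 0 w) -> F2 w.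
Proof.
move=> red_w abw bal; rewrite -(red_id red_w).
have := red_sec_cat 0 w; rewrite abw addr0 sec0 cats0 /= => ->.
apply: derived_balanced bal; first exact: der_one.
- exact: der_mul.
- exact: der_inv.
- by move=> t _; apply: F1_edge_word.
Qed.

End Abelianization.

(** * Independence of characters of the diagonal torus *)

Section Characters.

Local Open Scope ring_scope.

(* Dedekind's argument: a relation evaluated at [g0 * g], minus [chi v0 g0] times
   the relation at [g], is a shorter relation. *)
Lemma characters_free (K : idomainType) (G : Type) (mul : G -> G -> G)
    (P : G -> Prop) (V : eqType) (chi : V -> G -> K) (s : seq V) (c : V -> K) :
    (forall g h, P g -> P h -> P (mul g h)) ->
    (forall v g h, P g -> P h -> chi v (mul g h) = chi v g * chi v h) ->
    (forall v, exists2 g, P g & chi v g != 0) ->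
    (forall v v', v != v' -> exists2 g, P g & chi v g != chi v' g) ->
    uniq s -> (forall g, P g -> \sum_(v <- s) c v * chi v g = 0) ->
  forall v, v \in s -> c v = 0.
Proof.
move=> PM chiM nz sep; elim: s c => // v0 s IH c /= /andP[v0s uniq_s] rel.
have c0 v : v \in s -> c v = 0.
  move=> vs; have /sep[g0 Pg0 sep_g0] : v != v0.
    by apply: contraNneq v0s => <-.
  suff /eqP : c v * (chi v g0 - chi v0 g0) = 0.
    by rewrite mulf_eq0 subr_eq0 (negbTE sep_g0) orbF => /eqP.
  apply: (IH (fun v => c v * (chi v g0 - chi v0 g0)) uniq_s) vs => g Pg /=.
  have := rel _ (PM _ _ Pg0 Pg); rewrite big_cons.
  rewrite (eq_bigr (fun v => c v * (chi v g0 - chi v0 g0) * chi v g +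
     chi v0 g0 * (c v * chi v g))); last first.
    by move=> u _; rewrite chiM //; ring.
  rewrite big_split /= -mulr_sumr.
  have -> : \sum_(u <- s) c u * chi u g = - (c v0 * chi v0 g).
    by have /eqP := rel g Pg; rewrite big_cons addr_eq0 => /eqP->; rewrite opprK.
  by rewrite chiM // => rel0; rewrite -[RHS]rel0; ring.
move=> v; rewrite inE => /orP[/eqP->|/c0//].
have [g Pg nzg] := nz v0; have := rel g Pg.
rewrite big_cons big_seq big1 ?addr0; last by move=> u /c0->; rewrite mul0r.
by move/eqP; rewrite mulf_eq0 (negbTE nzg) orbF => /eqP.
Qed.

Variables (K : fieldType) (n : nat).
Implicit Types (lam : 'I_n -> K) (v : {ffun 'I_n -> int}).

Definition chi v lam : K := \prod_i lam i ^ v i.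

Lemma chiD v v' lam : (forall i, lam i != 0) ->
  chi (v + v') lam = chi v lam * chi v' lam.
Proof.
move=> nz; rewrite -big_split; apply: eq_bigr => i _.
by rewrite ffunE expfzDr.
Qed.

Lemma chiN v lam : chi (- v) lam = (chi v lam)^-1.
Proof.
rewrite /chi -prodfV; apply: eq_bigr => i _.
by rewrite ffunE -invr_expz.
Qed.

Lemma chi0 lam : chi 0 lam = 1.
Proof. by rewrite /chi big1 // => i _; rewrite ffunE expr0z. Qed.

Lemma chi_unit_vec i lam : chi (unit_vec i) lam = lam i.
Proof.
rewrite /chi (bigD1 i) //= big1 => [|j /negbTE neq_ji]; rewrite ffunE.
  by rewrite eqxx expr1z mulr1.
by rewrite neq_ji expr0z.
Qed.

Lemma chi_neq0 v lam : (forall i, lam i != 0) -> chi v lam != 0.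
Proof.
by move=> nz; apply/prodf_neq0 => i _; apply: expfz_neq0.
Qed.

Lemma chi_at_two v i :
  chi v (fun j => if j == i then 2 else 1) = 2 ^ v i.
Proof.
rewrite /chi (bigD1 i) //= eqxx big1 ?mulr1 // => j /negbTE->.
by rewrite exp1rz.
Qed.

Hypothesis pchar0 : [pchar K] =i pred0.

Lemma natr_inj (m p : nat) : m%:R = p%:R :> K -> m = p.
Proof.
have /pcharf0P nat0 := pchar0.
wlog le_mp : m p / (m <= p)%N => [wl /esym|/eqP].
  case/orP: (leq_total m p) => le eq_mp; first exact: wl (esym _).
  exact/esym/wl.
rewrite eq_sym -subr_eq0 -natrB // nat0 subn_eq0 => le_pm.
by apply/eqP; rewrite eqn_leq le_mp.
Qed.

Lemma two_neq0 : 2 != 0 :> K.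
Proof. by have /pcharf0P-> := pchar0. Qed.

Lemma exp2z_eq1 (k : int) : 2 ^ k = 1 :> K -> k = 0.
Proof.
have pow2_eq1 p : 2 ^+ p = 1 :> K -> p = 0%N.
  move=> pow1; have : (2 ^ p = 1)%N by apply: natr_inj; rewrite natrX.
  by case: p {pow1} => // p; rewrite expnS; lia.
case: k => p; first by move/pow2_eq1->.
by move/(congr1 GRing.inv); rewrite invr1 NegzE -exprnN invrK => /pow2_eq1.
Qed.

(** Put 2 in a coordinate where [v] and [v'] differ and 1 elsewhere: in characteristic 0 the element
    2 has infinite order, so squaring loses nothing. *)
Lemma chi_sqr_sep v v' : v != v' ->
  exists2 lam, (forall i, lam i != 0) & chi v lam ^+ 2 != chi v' lam ^+ 2.
Proof.
move=> neq_v; have [i neq_i] : exists i, v i != v' i.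
  apply/existsP; apply: contraNT neq_v => /existsPn eq_v.
  by apply/eqP/ffunP => i; apply/eqP; rewrite -[_ == _]negbK.
have nz j : (if j == i then 2 else 1) != 0 :> K.
  by case: ifP => _; rewrite ?oner_eq0 ?two_neq0.
exists (fun j => if j == i then 2 else 1) => //.
apply: contraNneq neq_i => /eqP; rewrite -subr_eq0 => eq_chi.
have: 2 ^ (v i - v' i + (v i - v' i)) = 1 :> K.
  rewrite !expfzDr ?two_neq0 // -invr_expz -!chi_at_two -expr2 exprMn exprVn.
  move: eq_chi; rewrite subr_eq0 => /eqP->.
  by rewrite divff // expf_neq0 // chi_neq0.
by move/exp2z_eq1; lia.
Qed.

End Characters.

(** * Conjugacy of 2x2 matrices *)

Section TwoByTwo.

Local Open Scope ring_scope.

Variable K : fieldType.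
Implicit Types A B P : 'M[K]_2.

Definition mx2 (a b c d : K) : 'M[K]_2 :=
  \matrix_(i, j) if i == 0 then (if j == 0 then a else b)
                 else (if j == 0 then c else d).

Lemma mx2_eta A : A = mx2 (A 0 0) (A 0 1) (A 1 0) (A 1 1).
Proof.
by apply/matrixP => -[[|[|i]] Hi] // -[[|[|j]] Hj] //; rewrite mxE /=;
  congr (A _ _); apply: val_inj.
Qed.

Lemma mx2M a b c d a' b' c' d' :
  mx2 a b c d * mx2 a' b' c' d' =
  mx2 (a * a' + b * c') (a * b' + b * d') (c * a' + d * c') (c * b' + d * d').
Proof.
apply/matrixP => i j; rewrite [LHS]mxE !big_ord_recl big_ord0 !mxE /= addr0.
by case: (i == 0); case: (j == 0).
Qed.

Lemma mx2_1 : 1 = mx2 1 0 0 1.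
Proof. by rewrite [LHS]mx2_eta !mxE. Qed.

Lemma det_mx2 a b c d : \det (mx2 a b c d) = a * d - b * c.
Proof.
rewrite (expand_det_row _ 0) !big_ord_recl big_ord0 /cofactor !det_mx11 !mxE /=.
by rewrite /bump /= expr0 expr1; ring.
Qed.

Lemma mxtrace_mx2 a b c d : \tr (mx2 a b c d) = a + d.
Proof. by rewrite /mxtrace !big_ord_recl big_ord0 !mxE /= addr0. Qed.

Lemma mxtrace2 A : \tr A = A 0 0 + A 1 1.
Proof. by rewrite {1}[A]mx2_eta mxtrace_mx2. Qed.

Lemma scale_mx2 k a b c d :
  k *: mx2 a b c d = mx2 (k * a) (k * b) (k * c) (k * d).
Proof. by rewrite [LHS]mx2_eta !mxE. Qed.

Lemma mx2_add a b c d a' b' c' d' :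
  mx2 a b c d + mx2 a' b' c' d' = mx2 (a + a') (b + b') (c + c') (d + d').
Proof. by rewrite [LHS]mx2_eta !mxE. Qed.

(** The rows of [P] are a cyclic vector (p, q) and its image (p, q) A; by Cayley-Hamilton [A]
    becomes a companion matrix in this basis. *)
Lemma cyclic_basis A : ~~ is_scalar_mx A ->
  exists2 P, P \is a GRing.unit &
    P * A = mx2 0 1 (- \det A) (\tr A) * P.
Proof.
rewrite [A]mx2_eta; set a := A 0 0; set b := A 0 1; set c := A 1 0; set d := A 1 1.
move=> nscal.
(* This quadratic form is the determinant of the rows (p, q) and (p, q) A; for non-scalar [A] one of
   (1, 0), (0, 1), (1, 1) is not a zero of it. *)
have [p [q nz]] : exists p q, p ^+ 2 * b + p * q * (d - a) - q ^+ 2 * c != 0.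
  have [b0|b0] := eqVneq b 0; last first.
    by exists 1, 0; rewrite expr1n expr0n /= !mulr0 !mul0r mul1r addr0 subr0.
  have [c0|c0] := eqVneq c 0; last first.
    by exists 0, 1; rewrite expr1n expr0n /= !mul0r mul1r add0r sub0r oppr_eq0.
  exists 1, 1; rewrite b0 c0 !mulr0 !mul1r add0r subr0 subr_eq0.
  apply: contra nscal => /eqP ->; rewrite b0 c0.
  by apply/is_scalar_mxP; exists a; rewrite [RHS]mx2_eta !mxE.
exists (mx2 p q (p * a + q * c) (p * b + q * d)).
  rewrite unitmxE det_mx2 unitfE; apply: contra_neq nz => <-; ring.
rewrite det_mx2 mxtrace_mx2 !mx2M; congr mx2; ring.
Qed.

(** Both matrices are conjugate to the same companion matrix. *)
Lemma conj_of_invariants A B :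
    ~~ is_scalar_mx A -> ~~ is_scalar_mx B ->
    \tr A = \tr B -> \det A = \det B ->
  exists2 P, P \is a GRing.unit & A = P^-1 * B * P.
Proof.
move=> /cyclic_basis[P uP PA] /cyclic_basis[Q uQ QB] eq_tr eq_det.
exists (Q^-1 * P); first by rewrite unitrMl // unitrV.
rewrite invrM ?unitrV // invrK -!mulrA (mulrA Q B) QB.
rewrite -eq_tr -eq_det -mulrA (mulrA Q) mulrV // mul1r -PA.
by rewrite mulrA mulVr // mul1r.
Qed.

End TwoByTwo.

(** * Words on upper triangular matrices *)

Section TriangularWords.

Local Open Scope ring_scope.

Variables (K : fieldType) (n : nat).
Implicit Types (lam mu : 'I_n -> K) (w : fword n) (v : {ffun 'I_n -> int}).

Definition upper lam mu (i : 'I_n) : 'M[K]_2 := mx2 (lam i) (mu i) 0 (lam i)^-1.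

Lemma SL2_upper lam mu i : lam i != 0 -> SL2 (upper lam mu i).
Proof. by move=> nz; rewrite /SL2 det_mx2 mulr0 subr0 divff. Qed.

Lemma mx_inv_uniq (A B : 'M[K]_2) : A * B = 1 -> A^-1 = B.
Proof.
move=> AB; have /mulmx1_unit[uA _] : A *m B = 1%:M by [].
by rewrite -[RHS]mul1r -(mulVr uA) -mulrA AB mulr1.
Qed.

Lemma invr_upper lam mu i : lam i != 0 ->
  (upper lam mu i)^-1 = mx2 (lam i)^-1 (- mu i) 0 (lam i).
Proof.
move=> nz; apply: mx_inv_uniq; rewrite mx2M mx2_1.
by congr mx2; field.
Qed.

Definition sgn (b : bool) : K := if b then -1 else 1.

(* Weighting by [chi v ^+ 2] makes the contribution of a letter depend only on
   the edge it crosses, up to sign. *)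
Lemma word_map_upper lam mu v w : (forall i, lam i != 0) ->
  exists2 o, word_map w (upper lam mu) =
             mx2 (chi (ab w) lam) o 0 (chi (ab w) lam)^-1 &
    chi v lam ^+ 2 * chi (ab w) lam * o =
    \sum_(t <- path_edges v w)
       sgn t.2 * (mu t.1.2 * lam t.1.2) * chi t.1.1 lam ^+ 2.
Proof.
move=> nz; elim: w v => [|a w IH] v.
  exists 0; last by rewrite mulr0 big_nil.
  by rewrite /word_map /ab !big_nil chi0 invr1 mx2_1.
have [o wE oE] := IH (v + ab_letter a).
have nzw := chi_neq0 (ab w) nz; have nzv := chi_neq0 v nz.
have la := nz a.1; rewrite ab_cons chiD //.
exists (chi (ab_letter a) lam * o + sgn a.2 * mu a.1 / chi (ab w) lam).
  rewrite /word_map big_cons -/(word_map w _) wE.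
  case: a {IH oE} la => i [] /= nzi; rewrite /ab_letter /sgn /=.
    rewrite invr_upper // mx2M chiN chi_unit_vec.
    by congr mx2; field; rewrite ?nzi ?nzw.
  by rewrite /upper mx2M chi_unit_vec; congr mx2; field; rewrite ?nzi ?nzw.
rewrite /= big_cons -oE chiD //.
case: a {IH oE} la => i [] /= nzi; rewrite /ab_letter /step /sgn /=.
  by rewrite !chiD // chiN chi_unit_vec; field; rewrite ?nzi ?nzw.
by rewrite chi_unit_vec; field; rewrite ?nzi ?nzw.
Qed.

(** In direction [i], the coefficient of the squared character of [u] is the signed number of
    crossings of the edge [(u, i)]. Independence makes it zero in [K], and characteristic 0 turns
    this into an equality of natural numbers. *)
Lemma balanced_of_characters (L : seq ({ffun 'I_n -> int} * 'I_n * bool)) :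
    [pchar K] =i pred0 ->
    (forall i lam, (forall j, lam j != 0) ->
       \sum_(t <- L | t.1.2 == i) sgn t.2 * chi t.1.1 lam ^+ 2 = 0) ->
  balanced L.
Proof.
move=> char0 rel [u i]; apply: (natr_inj char0); apply/eqP.
rewrite -subr_eq0 -sum_signs; apply/eqP.
have [u_in|u_notin] := boolP (u \in undup [seq t.1.1 | t <- L]); last first.
  rewrite big_seq_cond big1 // => t /andP[tL /eqP tu]; case/negP: u_notin.
  by rewrite mem_undup; apply/mapP; exists t; rewrite ?tu.
apply: (@characters_free K ('I_n -> K) (fun l l' j => l j * l' j)
  (fun lam => forall j, lam j != 0) _ (fun v lam => chi v lam ^+ 2) _
  (fun u => \sum_(t <- L | t.1 == (u, i)) sgn t.2)) (undup_uniq _) _ u u_in.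
- by move=> g h Pg Ph j; rewrite mulf_neq0.
- move=> v g h Pg Ph; rewrite -exprMn; congr (_ ^+ 2).
  by rewrite /chi -big_split; apply: eq_bigr => j _; rewrite expfzMl.
- move=> v; exists (fun=> 1) => [j|]; first exact: oner_neq0.
  by rewrite expf_neq0 // chi_neq0 // => j; apply: oner_neq0.
- by move=> v v'; apply: chi_sqr_sep.
move=> lam nz; rewrite -[RHS](rel i lam nz).
(* Exchanging the two sums turns the sum over vertices back into the sum over crossings in [rel]. *)
under eq_bigr do rewrite mulr_suml big_mkcond /=.
rewrite exchange_big [RHS]big_mkcond big_seq [RHS]big_seq.
apply: eq_bigr => -[[v j] b] tL /=.
rewrite (bigD1_seq v) ?undup_uniq //=; last first.
  by rewrite mem_undup; apply/mapP; exists (v, j, b).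
rewrite big1 ?addr0 => [|v' /negbTE neq_v']; rewrite xpair_eqE ?eqxx //.
by rewrite eq_sym neq_v'.
Qed.

Lemma upper_nontrivial w :
    [pchar K] =i pred0 -> reduced w -> F1 w -> ~ F2 w ->
  exists x : 'I_n -> 'M[K]_2, (forall i, SL2 (x i)) /\
    exists2 o, o != 0 & word_map w x = mx2 1 o 0 1.
Proof.
move=> char0 red_w /ab_derived abw nF2; apply: NNPP => triv; apply: nF2.
apply: F2_balanced => //; apply: balanced_of_characters => // i lam nz.
(* With [mu] the indicator of [i], only edges in direction [i] contribute to the off-diagonal
   entry. *)
have [o] := word_map_upper (fun j => (j == i)%:R) 0 w nz.
rewrite abw chi0 invr1 expr1n !mul1r => wE.
have -> : o = 0.
  apply/eqP/negP => /negP o_neq0; apply: triv.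
  exists (upper lam (fun j => (j == i)%:R)); split; last by exists o.
  by move=> j; apply: SL2_upper.
(* Every surviving term of [sum0] carries the factor [lam i]. *)
move=> sum0; apply: (mulfI (nz i)).
rewrite mulr0 [RHS]sum0 mulr_sumr big_mkcond; apply: eq_bigr => t _ /=.
by case: eqP => [->|_] /=; ring.
Qed.

End TriangularWords.

(** * Word maps and simultaneous conjugation *)

Section WordMaps.

Local Open Scope ring_scope.

Variables (K : fieldType) (n : nat).
Implicit Types (w : fword n) (x : 'I_n -> 'M[K]_2).

Lemma SL2_unit (A : 'M[K]_2) : SL2 A -> A \is a GRing.unit.
Proof. by rewrite /SL2 -[_ \is a _]/(A \in unitmx) unitmxE => ->; apply: unitr1. Qed.

Lemma SL2_scalar (A : 'M[K]_2) : SL2 A -> is_scalar_mx A -> A = 1 \/ A = -1.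
Proof.
move=> SLA /is_scalar_mxP[c AE]; move: SLA; rewrite /SL2 AE det_scalar.
move/eqP; rewrite sqrf_eq1 => /orP[]/eqP->; first by left.
by right; rewrite raddfN.
Qed.

Lemma word_map1 w : word_map w (fun=> 1 : 'M[K]_2) = 1.
Proof. by apply: big1 => a _; rewrite invr1 if_same. Qed.

Lemma SL2_word_map w x : (forall i, SL2 (x i)) -> SL2 (word_map w x).
Proof.
move=> SLx; rewrite /word_map /SL2; elim: w => [|a w IH].
  by rewrite big_nil det1.
rewrite big_cons det_mulmx IH mulr1.
by case: a.2; rewrite ?det_inv SLx ?invr1.
Qed.

Lemma word_map_conj w x P :
    (forall i, SL2 (x i)) -> P \is a GRing.unit ->
  word_map w (fun i => P^-1 * x i * P) = P^-1 * word_map w x * P.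
Proof.
move=> SLx uP; rewrite /word_map; elim: w => [|a w IH].
  by rewrite !big_nil mulr1 mulVr.
rewrite !big_cons IH; set y := (if a.2 then (x a.1)^-1 else x a.1).
have -> : (if a.2 then (P^-1 * x a.1 * P)^-1 else P^-1 * x a.1 * P) =
    P^-1 * y * P.
  have ux := SL2_unit (SLx a.1); rewrite /y; case: a.2 => //.
  by rewrite !invrM ?unitrMl ?unitrV // invrK mulrA.
by rewrite !mulrA mulrK.
Qed.

(** The value of the word at [x] is conjugate to [g], and word maps commute with simultaneous
    conjugation. The conjugator need only be invertible, since conjugation preserves
    determinants. *)
Lemma word_map_reaches w x (g : 'M[K]_2) :
    (forall i, SL2 (x i)) -> ~~ is_scalar_mx (word_map w x) ->
    SL2 g -> ~~ is_scalar_mx g -> \tr g = \tr (word_map w x) ->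
  exists2 y, forall i, SL2 (y i) & word_map w y = g.
Proof.
move=> SLx nscal_w SLg nscal_g eq_tr.
have [|P uP gE] := conj_of_invariants nscal_g nscal_w eq_tr.
  by rewrite SLg SL2_word_map.
exists (fun i => P^-1 * x i * P); last by rewrite word_map_conj.
move=> i; rewrite /SL2 !det_mulmx SLx mulr1 det_inv mulVf //.
by rewrite -unitfE -unitmxE.
Qed.

End WordMaps.

(** * Every trace is attained *)

Section TraceSurjectivity.

Local Open Scope ring_scope.

Variables (K : closedFieldType) (n : nat).
Hypothesis pchar0 : [pchar K] =i pred0.
Implicit Types (a b : letter n) (w : fword n) (z : K).

(* Pairwise distinct points of the projective line, one for each letter. *)
Definition pt a : K := (a.1.*2 + a.2)%:R.

Lemma pt_inj : injective pt.
Proof.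
move=> [i b] [j c] /(natr_inj pchar0) /= eq_ij.
by congr (_, _); [apply: val_inj => /=|]; move: eq_ij; case: b; case: c => /=; lia.
Qed.

Lemma pt_linv a : pt a - pt (linv a) != 0.
Proof.
rewrite subr_eq0; apply/eqP => /pt_inj /(congr1 snd) /=.
by case: (a.2).
Qed.

(* The column (1, pt a) times the row (- pt (linv b), 1). *)
Definition rank1 a b := mx2 (- pt (linv b)) 1 (- (pt a * pt (linv b))) (pt a).

Lemma rank1M a b c d :
  rank1 a b * rank1 c d = (pt c - pt (linv b)) *: rank1 a d.
Proof. by rewrite mx2M scale_mx2; congr mx2; ring. Qed.

Lemma mxtrace_rank1 a b : \tr (rank1 a b) = pt a - pt (linv b).
Proof. by rewrite mxtrace_mx2 addrC. Qed.

(** The projection onto the line of (1, [pt a]) along that of (1, [pt (linv a)]). *)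
Definition proj a := (pt a - pt (linv a))^-1 *: rank1 a a.

Definition gen z a := z *: proj a + z^-1 *: proj (linv a).

Lemma gen_mx2 z a : gen z a =
  let d := (pt a - pt (linv a))^-1 in
  mx2 (d * (z^-1 * pt a - z * pt (linv a))) (d * (z - z^-1))
      (d * pt a * pt (linv a) * (z^-1 - z)) (d * (z * pt a - z^-1 * pt (linv a))).
Proof.
rewrite /gen /proj /rank1 linvK !scale_mx2 mx2_add.
rewrite -[pt (linv a) - pt a]opprB invrN; move: (_^-1) => d.
by congr mx2; ring.
Qed.

Lemma genN z a : z != 0 -> gen z a * gen z (linv a) = 1.
Proof.
move=> nz; rewrite !gen_mx2 /= linvK mx2M mx2_1.
rewrite -[pt (linv a) - pt a]opprB invrN.
have /mulfV := pt_linv a; move: (pt a) (pt (linv a)) => p q.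
move: (_^-1) => d dE.
(* Once both diagonal ones are homogenized, the identities hold for independent [p], [q], [d]. *)
have {1}-> : 1 = ((p - q) * d) ^+ 2 by rewrite dE expr1n.
have {1}-> : 1 = ((p - q) * d) ^+ 2 by rewrite dE expr1n.
by congr mx2; field.
Qed.

Lemma SL2_gen z a : z != 0 -> SL2 (gen z a).
Proof.
move=> nz; rewrite /SL2 gen_mx2 /= det_mx2.
have /mulfV := pt_linv a; move: (pt a) (pt (linv a)) => p q.
move: (_^-1) => d dE; have -> : 1 = ((p - q) * d) ^+ 2 by rewrite dE expr1n.
by field.
Qed.

Lemma word_map_gen z w : z != 0 ->
  word_map w (fun i => gen z (i, false)) = \prod_(a <- w) gen z a.
Proof.
move=> nz; apply: eq_bigr => -[i []] _ //=.
by rewrite (mx_inv_uniq (genN (i, false) nz)).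
Qed.

(** Scaling each letter by [z] clears the negative powers. *)
Lemma prod_scaled_gen z w : z != 0 ->
  \prod_(a <- w) (proj (linv a) + z ^+ 2 *: proj a) =
  z ^+ size w *: \prod_(a <- w) gen z a.
Proof.
move=> nz; elim: w => [|a w IH]; first by rewrite !big_nil scale1r.
rewrite !big_cons IH; have -> : proj (linv a) + z ^+ 2 *: proj a = z *: gen z a.
  by rewrite scalerDr (scalerA z z) (scalerA z z^-1) divff // scale1r addrC.
by rewrite -scalerAl -scalerAr (scalerA z) -exprS.
Qed.

(** Rank one products telescope; consecutive letters [a], [b] contribute [pt b - pt (linv a)],
    non-zero because the word is reduced. *)
Lemma prod_proj a w : reduced (a :: w) ->
  exists2 c, c != 0 &
    \prod_(b <- a :: w) proj b = c *: rank1 a (last a w).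
Proof.
elim: w a => [|b w IH] a.
  by exists (pt a - pt (linv a))^-1; rewrite ?invr_eq0 ?pt_linv // big_seq1.
move=> /andP[neq_ba /IH[c nzc prodE]].
exists ((pt a - pt (linv a))^-1 * c * (pt b - pt (linv a))).
  rewrite !mulf_neq0 ?invr_eq0 ?pt_linv // subr_eq0.
  by apply: contra neq_ba => /eqP/pt_inj->.
rewrite big_cons prodE -scalerAr -scalerAl rank1M !scalerA.
by congr (_ *: _); ring.
Qed.

Lemma mxtrace_prod_proj a w :
  reduced (a :: w) -> last a w != linv a ->
  \tr (\prod_(b <- a :: w) proj b) != 0.
Proof.
move=> /prod_proj[c nzc ->] neq_last.
rewrite mxtraceZ mxtrace_rank1 mulf_neq0 // subr_eq0.
by apply: contra neq_last => /eqP/pt_inj eq_a; rewrite [in linv a]eq_a linvK.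
Qed.

(** The top coefficient, at twice the number of factors, arises by choosing the second matrix in
    every factor. *)
Lemma prod_pencil (s : seq ('M[K]_2 * 'M[K]_2)) :
  exists W : 'M[{poly K}]_2,
    (forall z i j,
       (W i j).[z] = (\prod_(p <- s) (p.1 + z ^+ 2 *: p.2)) i j) /\
    (forall i j m, ((size s).*2 <= m)%N ->
       (W i j)`_m =
       if m == (size s).*2 then (\prod_(p <- s) p.2) i j else 0).
Proof.
elim: s => [|[A B] s [W [WE Wm]]].
  exists 1; split=> [z i j|i j m _].
    by rewrite big_nil !mxE; case: eqP; rewrite ?hornerC ?horner0.
  rewrite big_nil !mxE; case: (i == j); rewrite /= ?coef1 ?coef0.
    by case: eqP.
  by rewrite if_same.
exists (\matrix_(i, j) \sum_k ((A i k)%:P * W k j + 'X^2 * ((B i k)%:P * W k j))).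
split=> [z i j|i j m le_m].
  rewrite big_cons !mxE horner_sum; apply: eq_bigr => k _.
  by rewrite !mxE /= -WE !hornerE /=; ring.
rewrite big_cons !mxE coef_sum; case: m le_m => [|[|m]] // le_m.
have coefE k : ((A i k)%:P * W k j + 'X^2 * ((B i k)%:P * W k j))`_m.+2 =
    B i k * (if m == (size s).*2 then (\prod_(p <- s) p.2) k j else 0).
  rewrite coefD coefXnM /= !coefCM subn2 /= !Wm; try by move: le_m => /=; lia.
  have -> : (m.+2 == (size s).*2) = false by move: le_m => /=; lia.
  by rewrite mulr0 add0r.
rewrite (eq_bigr _ (fun k _ => coefE k)) /= !eqSS.
by case: eqP => // _; rewrite big1 // => k _; rewrite mulr0.
Qed.

Lemma reduced_map_linv w : reduced (map (@linv n) w) = reduced w.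
Proof.
rewrite !reducedE sorted_map; apply: eq_sorted => a b /=.
by rewrite (inj_eq (can_inj (@linvK n))).
Qed.

(** Multiplied by z^L, the equation trace = [t] becomes [q] = 0. The coefficient of [q] at 2L and
    its constant term are non-zero, so [q] has a root and that root is not 0. *)
Lemma cyclically_reduced_trace a w t :
    reduced (a :: w) -> last a w != linv a ->
  exists x : 'I_n -> 'M[K]_2,
    (forall i, SL2 (x i)) /\ \tr (word_map (a :: w) x) = t.
Proof.
move=> red_w neq_last; set w' := a :: w; pose L := size w'.
have [W [WE Wm]] := prod_pencil [seq (proj (linv b), proj b) | b <- w'].
pose q := W 0 0 + W 1 1 - t *: 'X^L.
have evalE z : (W 0 0 + W 1 1).[z] =
    \tr (\prod_(b <- w') (proj (linv b) + z ^+ 2 *: proj b)).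
  by rewrite hornerD !WE big_map mxtrace2.
have q_top : q`_L.*2 != 0.
  rewrite coefB coefD coefZ coefXn.
  have -> : (L.*2 == L) = false by rewrite /L /=; lia.
  rewrite mulr0 subr0 !Wm size_map ?leqnn // eqxx big_map.
  by rewrite -mxtrace2 mxtrace_prod_proj.
have q_0 : q.[0] != 0.
  rewrite hornerD evalE hornerN hornerZ hornerXn [0 ^+ L]expr0n /L /= mulr0 subr0.
  (* At z = 0 only the projections of the inverse letters remain, and these again form a cyclically
     reduced word. *)
  rewrite (eq_bigr (fun b => proj (linv b))); last first.
    by move=> b _; rewrite expr0n scale0r addr0.
  rewrite -(big_map (@linv n) xpredT) /= mxtrace_prod_proj //.
    by rewrite -[_ :: _]/(map (@linv n) (a :: w)) reduced_map_linv.
  by rewrite last_map (inj_eq (can_inj (@linvK n))).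
have /closed_rootP[z /rootP qz] : size q != 1.
  apply: contraNneq q_top => sz_q; rewrite nth_default // sz_q /L /=; lia.
have nz : z != 0 by apply: contraNneq q_0 => z0; rewrite z0 in qz; rewrite qz.
exists (fun i => gen z (i, false)); split=> [i|]; first exact: SL2_gen.
apply: (mulfI (expf_neq0 L nz)).
rewrite word_map_gen // -mxtraceZ -prod_scaled_gen // -evalE.
move/eqP: qz; rewrite (hornerD (W 0 0 + W 1 1)) hornerN hornerZ hornerXn subr_eq0.
by move/eqP->; rewrite mulrC.
Qed.

(** If the last letter is inverse to the first, stripping both is a conjugation and keeps the trace;
    the remaining word is non-empty because [w] is reduced. *)
Lemma trace_surjective w t : reduced w -> w != [::] ->
  exists x : 'I_n -> 'M[K]_2,
    (forall i, SL2 (x i)) /\ \tr (word_map w x) = t.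
Proof.
have [m] := ubnP (size w); elim: m w => // m IH [|a w] // sz_w red_w _.
have [last_w|] := eqVneq (last a w) (linv a); last exact: cyclically_reduced_trace.
case/lastP: w last_w sz_w red_w => [|w b]; first by case: a => i [].
rewrite last_rcons => -> sz_w red_w.
have [|||x [SLx trx]] := IH w.
- by move: sz_w; rewrite /= size_rcons; lia.
- by move: red_w; rewrite !reducedE /= rcons_path => /andP[/path_sorted].
- by apply: contraTneq red_w => ->; rewrite /= eqxx.
exists x; split=> //; rewrite -trx /word_map big_cons -cats1 big_cat big_seq1 /=.
rewrite [LHS]mxtrace_mulC -mulmxA; set y := (X in \tr (_ *m X)).
have -> : y = 1.
  have /SL2_unit ux := SLx a.1.
  by rewrite /y; case: a.2; [apply: mulrV|apply: mulVr].
by rewrite [_ *m _]mulr1.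
Qed.

End TraceSurjectivity.

(* PSL(2,K) = SL(2,K)/{+-1}: surjectivity of the induced word map means every
   g in SL(2,K) equals w(x) up to sign for some x in SL(2,K)^n. *)
Theorem theorem1p3 (n : nat) (hn : (2 <= n)%N)
  (K : closedFieldType) (hK : ([pchar K]%R =i pred0))
  (w : fword n) (hw : reduced w) (h1 : F1 w) (h2 : ~ F2 w) :
  forall g : 'M[K]_2, SL2 g ->
    exists x : 'I_n -> 'M[K]_2,
      (forall i, SL2 (x i)) /\
      (word_map w x = g \/ word_map w x = (- g)%R).
Proof.
move=> g SLg.
have [/(SL2_scalar SLg) g_pm1|nscal_g] := boolP (is_scalar_mx g).
  exists (fun=> 1%R); split=> [i|]; first exact: det1.
  by rewrite word_map1; case: g_pm1 => ->; [left|right; rewrite opprK].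
have [x [SLx [o o_neq0 wx]]] := upper_nontrivial hK hw h1 h2.
have nscal_wx : ~~ is_scalar_mx (word_map w x).
  rewrite wx; apply/is_scalar_mxP => -[c /matrixP/(_ 0%R 1%R)].
  by rewrite !mxE /=; apply/eqP.
have tr_wx : (\tr (word_map w x) = 2)%R by rewrite wx mxtrace_mx2.
have [tr_g|tr_g] := eqVneq (\tr g)%R 2%R.
  have [|x' SLx' wx'] := word_map_reaches SLx nscal_wx SLg nscal_g.
    by rewrite tr_wx.
  by exists x'; split=> //; left.
(* At trace -2, [- g] is conjugate to the unipotent value; the sign is absorbed in PSL. *)
have [tr_Ng|tr_Ng] := eqVneq (\tr g)%R (- 2)%R.
  have SLNg : SL2 (- g)%R by rewrite /SL2 -scaleN1r detZ sqrrN expr1n mul1r.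
  have nscal_Ng : ~~ is_scalar_mx (- g)%R.
    apply: contra nscal_g => /is_scalar_mxP[c gE].
    by apply/is_scalar_mxP; exists (- c)%R; rewrite -[g]opprK gE raddfN.
  have [|x' SLx' wx'] := word_map_reaches SLx nscal_wx SLNg nscal_Ng.
    by rewrite tr_wx raddfN /= tr_Ng opprK.
  by exists x'; split=> //; right.
have w_neq : w != [::].
  by apply/eqP => w_nil; apply: h2; rewrite w_nil; apply: der_one.
have [y [SLy tr_y]] := trace_surjective hK (\tr g)%R hw w_neq.
(* A scalar value would be 1 or -1, of trace 2 or -2, both now excluded. *)
have nscal_wy : ~~ is_scalar_mx (word_map w y).
  apply/negP => /(SL2_scalar (SL2_word_map w SLy))[] wyE;
    move: tr_y; rewrite wyE ?raddfN /= mxtrace1 => tr_y;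
    by rewrite -tr_y eqxx in tr_g tr_Ng.
have [|x' SLx' wx'] := word_map_reaches SLy nscal_wy SLg nscal_g => //.
by exists x'; split=> //; left.
Qed.
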